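(* Let $m \geq 2$ and $n_1,\ldots,n_m\geq 1$ be integers with at least one $n_i \geq 2$, and let $\mathcal{J}=\{(i,j): 1\leq i\leq m,\ 1\leq j\leq n_i\}$. Let real numbers $a_{ij}, c_{ij}$ ($(i,j)\in\mathcal{J}$) and $b_i,d_i$ ($1\leq i\leq m$) satisfy: (i) $0<a_{ij}<b_i<1$ for each $(i,j)\in\mathcal{J}$, $\sum_{i=1}^m b_i\leq 1$, and $\sum_{j=1}^{n_i}a_{ij}\leq 1$ for each $i$; (ii) $0\leq d_1<d_2<\cdots<d_m<1$, $d_{i+1}\geq d_i+b_i$ for $1\leq i<m$, and $d_m+b_m\leq 1$; (iii) for each $i$, $0\leq c_{i1}<c_{i2}<\cdots<c_{in_i}<1$, $c_{i(j+1)}\geq c_{ij}+a_{ij}$ for $1\leq j<n_i$, and $c_{in_i}+a_{in_i}\leq 1$. Let $S\subset[0,1]^2$ be the self-affine limit set generated by the maps $A_{ij}:\mathbb{R}^2\to\mathbb{R}^2$, $A_{ij}(x,y)=(a_{ij}x+c_{ij},\ b_iy+d_i)$, $(i,j)\in\mathcal{J}$. Let $\beta_y\in(0,1]$ be the solution of $\sum_{i=1}^m b_i^{\beta_y}=1$, and let $$\beta_x=\max\Big\{a : \exists\, i\in\{1,\ldots,m\} \text{ with } \sum_{j=1}^{n_i}a_{ij}^{a}=1\Big\}\in(0,1].$$ Then the Assouad dimension of $S$ is $$\dim_A(S)=\beta_x+\beta_y.$$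
   Context: The limit set $S$ of the maps $A_{ij}$ is the unique non-empty compact set with $S=\bigcup_{(i,j)\in\mathcal{J}}A_{ij}(S)$; it carries the Euclidean metric. The Assouad dimension $\dim_A(X)$ of a metric space $X$ is the infimum of all $\alpha>0$ for which there exists a constant $C>0$ such that for any $r,R$ with $0 < r \leq \frac12 R \leq \operatorname{diam}(X)$, any ball $B(x,R)\subset X$ may be covered by at most $C (R/r)^\alpha$ balls of radius $r$. *)

(* Defs.v *)
From mathcomp Require Import all_boot all_order all_algebra.
From mathcomp Require Import all_classical all_reals all_analysis.

Set Implicit Arguments.
Unset Strict Implicit.
Unset Printing Implicit Defensive.

Import Order.TTheory GRing.Theory Num.Theory.
Import numFieldNormedType.Exports.

Local Open Scope classical_set_scope.
Local Open Scope ring_scope.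

Section MetricSpace.
Context {R : realType} {T : Type} (dist : T -> T -> R).

(* A metric space is a carrier X : set T together with dist restricted to X,
   so balls are balls of X (open, relative to X). *)
Definition mball (X : set T) (x : T) (r : R) : set T :=
  [set y | X y /\ dist x y < r].

(* Extended-real valued, since a metric space may be unbounded. *)
Definition diameter (X : set T) : \bar R :=
  ereal_sup [set e | exists x y, [/\ X x, X y & e = (dist x y)%:E]].

Definition covered_by_balls (X A : set T) (r N : R) : Prop :=
  exists (k : nat) (z : 'I_k -> T),
    [/\ forall i, X (z i), k%:R <= N &
        A `<=` \bigcup_(i in [set: 'I_k]) mball X (z i) r].

Definition assouad_exponent (X : set T) (alpha : R) : Prop :=
  exists2 C : R, 0 < C &
    forall r rho : R, 0 < r -> r <= rho / 2 -> ((rho / 2)%:E <= diameter X)%E ->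
    forall x, X x ->
      covered_by_balls X (mball X x rho) r (C * (rho / r) `^ alpha).

(* Extended-real valued: the infimum is +oo when there is no exponent. *)
Definition assouad_dim (X : set T) : \bar R :=
  ereal_inf
    [set alpha%:E | alpha in
       [set alpha : R | 0 < alpha /\ assouad_exponent X alpha]].

End MetricSpace.

(* The library metric on R * R is the sup metric, hence this definition; both
   metrics induce the product topology, so [compact] is unaffected. *)
Definition euclid_dist {R : realType} (p q : R * R) : R :=
  Num.sqrt ((p.1 - q.1) ^+ 2 + (p.2 - q.2) ^+ 2).

Section LimitSet.
Context {R : realType} {m : nat} {n : 'I_m -> nat}.
Variables (a c : forall i : 'I_m, 'I_(n i) -> R) (b d : 'I_m -> R).

Definition carpet_map (i : 'I_m) (j : 'I_(n i)) (p : R * R) : R * R :=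
  (a j * p.1 + c j, b i * p.2 + d i).

Definition is_limit_set (S : set (R * R)) : Prop :=
  [/\ S !=set0, compact S &
      S = \bigcup_(i in [set: 'I_m]) \bigcup_(j in [set: 'I_(n i)])
            (carpet_map j @` S)].

End LimitSet.

Definition is_maximum {R : realType} (A : set R) (x : R) : Prop :=
  A x /\ ubound A x.

(* Main.v *)
Require Import Defs.
From mathcomp Require Import all_boot all_order all_algebra.
From mathcomp Require Import all_classical all_reals all_analysis.
From mathcomp Require Import ring lra.

Import Order.TTheory GRing.Theory Num.Theory.
Import numFieldNormedType.Exports.

Local Open Scope classical_set_scope.
Local Open Scope ring_scope.

(** The attractor S is coded by digits (i, j): the maps are diagonal, so a word
    of digits w sends the unit square to a rectangle whose vertical side depends
    only on the word of rows i of w, while its horizontal side depends on all of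
    w.  Along each coordinate one sees a tree of nested intervals: in y the tree
    of the self-similar set with ratios b_i, and, over a given word of rows
    i_1 i_2 ..., in x the tree whose k-th level subdivides by the ratios
    a_(i_k)(j).  Since a_(ij) < b_i, once the vertical side is at most r so is
    the horizontal side.

    Counting on a tree.  [leaves r] stops each branch as soon as its interval
    has length at most r.  If every level satisfies sum a^beta <= 1, then the
    number of leaves meeting an interval of length of order rad is at most a
    constant times (rad / r)^beta ([leaves_hitting_count]): boundedly many nodes
    of length about rad meet that interval because they do not overlap, and
    below each of them the weight length^beta is not increased by subdivision.
    If sum a^beta = 1 on every level, there are at least r^(- beta) leaves
    ([leaves_size_ge]).

    Upper bound.  By maximality of betax, sum_j a_(ij)^betax <= 1 for every row
    i ([row_sum_le1]).  A ball of radius rho meets at most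
    const (rho / r)^betay row words of height about r and, over each of them, at
    most const (rho / r)^betax intervals of width about r; hence
    betax + betay is an exponent ([S_assouad_exponent]).

    Lower bound.  Let i0 be a row that realises betax.  Repeating the row i0
    l + k times, with the first l columns prescribed, gives a part of S that,
    for a suitable l, lives in a rectangle of comparable sides
    ([comparable_powers]).  Seen at the scale of this rectangle it contains a
    product: k levels of the Cantor set with ratios a_(i0 j) in x, the whole
    vertical structure of S in y.  At relative scale t it has at least
    t^(- betax - betay) pieces, and each ball of relative radius t meets boundedly
    many of them.  So any exponent alpha satisfies 1 <= M t^(betax + betay -
    alpha) for all t in (0, 1) ([exponent_lower_bound]), which forces
    alpha >= betax + betay. *)

(** * Trees of intervals *)

Section Clamp.
Context {R : realType}.
Implicit Types lo hi x y : R.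

Definition clamp lo hi x : R := Num.max lo (Num.min hi x).

Lemma clamp_homo lo hi : {homo clamp lo hi : x y / x <= y}.
Proof. by move=> x y xy; rewrite /clamp le_max2 // le_min2. Qed.

Lemma clamp_id lo hi x : lo <= x <= hi -> clamp lo hi x = x.
Proof. by move=> /andP[lx xh]; rewrite /clamp min_r // max_r. Qed.

Lemma clamp_diff_le lo hi x y : lo <= hi -> clamp lo hi y - clamp lo hi x <= hi - lo.
Proof.
move=> lh; apply: lerB; rewrite /clamp ?le_max ?lexx //.
by rewrite ge_max lh /= ge_min lexx.
Qed.

End Clamp.

(** An interval of length w starting at p is the pair (p, w); the letter x
    stands for the subinterval [ivl x] of [0, 1].  The levels of a tree are
    indexed by I: the letters available on a level l are those of [lev l]. *)
Section IntervalTree.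
Set Implicit Arguments.
Context {R : realType} {T : eqType} {I : eqType}.
Variables (ivl : T -> R * R) (lev : I -> seq T).
Implicit Types (J K : R * R) (v w : seq T) (ls : seq I) (r t : R).

Definition subinterval J K : R * R := (J.1 + J.2 * K.1, J.2 * K.2).

(** The interval reached by following the word v from [0, 1], the first letter
    giving the largest interval. *)
Definition piece v : R * R :=
  foldl (fun J x => subinterval J (ivl x)) (0, 1) v.

Lemma piece_rcons v x : piece (rcons v x) = subinterval (piece v) (ivl x).
Proof. by rewrite /piece foldl_rcons. Qed.

Lemma piece_ratio v : (piece v).2 = \prod_(x <- v) (ivl x).2.
Proof.
elim/last_ind: v => [|v x IH]; first by rewrite big_nil.
by rewrite piece_rcons /= IH big_rcons /= mulrC.
Qed.

Lemma piece_nseq_ratio k x : (piece (nseq k x)).2 = (ivl x).2 ^+ k.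
Proof.
rewrite piece_ratio; elim: k => [|k IH]; first by rewrite big_nil.
by rewrite big_cons IH exprS.
Qed.

(** The branches through v, cut at the first interval of length at most r, or
    at full depth when the levels ls are exhausted. *)
Fixpoint leaves r ls v : seq (seq T) :=
  if ls is l :: ls' then
    if (piece v).2 <= r then [:: v]
    else flatten [seq leaves r ls' (rcons v x) | x <- lev l]
  else [:: v].

(** All counts of leaves come from this: a weight that does not increase when a
    node is subdivided has total mass on the leaves at most its value at the
    root. *)
Lemma leaves_sum_le (phi : R * R -> R) r ls v :
  (forall w l, l \in ls -> r < (piece w).2 ->
     \sum_(x <- lev l) phi (subinterval (piece w) (ivl x)) <= phi (piece w)) ->
  \sum_(w <- leaves r ls v) phi (piece w) <= phi (piece v).
Proof.
elim: ls v => [|l ls IH] v Hphi /=; first by rewrite big_cons big_nil addr0.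
case: (leP (piece v).2 r) => hr; first by rewrite big_cons big_nil addr0.
rewrite big_flatten big_map /=.
apply: le_trans (Hphi v l (mem_head _ _) hr).
apply: ler_sum => x _; rewrite -piece_rcons; apply: IH => w l' l'ls.
by apply: Hphi; rewrite inE l'ls orbT.
Qed.

Lemma leaves_letters r ls v w : w \in leaves r ls v ->
  exists u, [/\ w = v ++ u, (size u <= size ls)%N &
    forall x, x \in u -> exists2 l, l \in ls & x \in lev l].
Proof.
elim: ls v => [|l ls IH] v /=.
  by rewrite inE => /eqP->; exists [::]; rewrite cats0.
case: (leP (piece v).2 r) => hr.
  by rewrite inE => /eqP->; exists [::]; rewrite cats0.
case/flatten_mapP => x xl /IH[u [-> su Hu]]; exists (x :: u).
split; [by rewrite cat_rcons | by [] | move=> y].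
rewrite inE => /orP[/eqP->|/Hu[l' l'ls yl']]; first by exists l; rewrite ?mem_head.
by exists l' => //; rewrite inE l'ls orbT.
Qed.

Lemma prefix_is_leaf r ls v w : all2 (fun l x => x \in lev l) ls w ->
  exists h, v ++ take h w \in leaves r ls v.
Proof.
elim: ls v w => [|l ls IH] v [|x w] //=.
  by move=> _; exists 0%N; rewrite cats0 mem_head.
case/andP => xl /IH{}IH; case: (leP (piece v).2 r) => hr.
  by exists 0%N; rewrite take0 cats0 mem_head.
have [h Hh] := IH (rcons v x); exists h.+1; rewrite /= -cat_rcons.
by apply/flatten_mapP; exists x.
Qed.

Variable amin : R.
Hypotheses (amin_gt0 : 0 < amin) (amin_le1 : amin <= 1).

(** A branch is only continued when its length exceeds r, so its last step ends
    at length at least amin * r. *)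
Lemma leaf_ge r ls v w :
  (forall l x, l \in ls -> x \in lev l -> amin <= (ivl x).2) -> 0 < r ->
  amin * r <= (piece v).2 -> w \in leaves r ls v -> amin * r <= (piece w).2.
Proof.
elim: ls v => [|l ls IH] v Ha r0 hv /=; first by rewrite inE => /eqP->.
case: (leP (piece v).2 r) => hr; first by rewrite inE => /eqP->.
case/flatten_mapP => x xl; apply: IH => //.
  by move=> l' y l'ls; apply: Ha; rewrite inE l'ls orbT.
rewrite piece_rcons /= mulrC ler_pM ?(ltW r0) ?(ltW hr) ?(ltW amin_gt0) //.
by apply: (Ha l); rewrite ?mem_head.
Qed.

Variable theta : I -> R.

(** The branches that reach full depth are short as soon as the product of the
    contraction bounds of the levels is small. *)
Lemma leaf_le r ls v w : (forall l, 0 <= theta l) ->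
  (forall l x, l \in ls -> x \in lev l -> 0 < (ivl x).2 <= theta l) ->
  0 <= (piece v).2 -> (piece v).2 * (\prod_(l <- ls) theta l) <= r ->
  w \in leaves r ls v -> (piece w).2 <= r.
Proof.
move=> theta0; elim: ls v => [|l ls IH] v Ha v0 hv /=.
  by rewrite inE => /eqP->; rewrite big_nil mulr1 in hv.
case: (leP (piece v).2 r) => hr; first by rewrite inE => /eqP->.
case/flatten_mapP => x xl.
have /andP[x0 xth] := Ha l x (mem_head _ _) xl.
apply: IH.
- by move=> l' y l'ls; apply: Ha; rewrite inE l'ls orbT.
- by rewrite piece_rcons /= mulr_ge0 // ltW.
- rewrite piece_rcons /=; apply: le_trans hv; rewrite big_cons mulrA.
  by rewrite ler_wpM2r ?prodr_ge0 // ler_wpM2l.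
Qed.

(** The intervals of l are nonoverlapping subintervals of [0, 1], expressed by
    what the counting uses: their images under a monotone function are still
    packed.  Applied to [clamp] it bounds the total length inside a window. *)
Definition packed (l : seq T) : Prop :=
  forall g : R -> R, {homo g : x y / x <= y} ->
    \sum_(x <- l) (g ((ivl x).1 + (ivl x).2) - g (ivl x).1) <= g 1 - g 0.

Definition hits e s J : bool := (J.1 <= e + s) && (e - s <= J.1 + J.2).

Hypothesis lev_ivl : forall l x, x \in lev l ->
  [/\ 0 <= (ivl x).1, amin <= (ivl x).2 & (ivl x).1 + (ivl x).2 <= 1].
Hypothesis lev_packed : forall l, packed (lev l).
Variable beta : R.
Hypothesis beta_ge0 : 0 <= beta.
Hypothesis lev_beta : forall l, \sum_(x <- lev l) (ivl x).2 `^ beta <= 1.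

(** This weight counts, up to constants, the leaves near e.  Below the scale rad
    it is the natural mass (length / rad)^beta of the nodes that matter; above
    it, it is the length inside a window slightly larger than the target, in
    units of amin * rad.  A node just below the scale rad that meets the target
    lies inside the window and has length at least amin * rad, hence the two
    regimes fit together. *)
Definition ball_weight kappa e rad J : R :=
  if J.2 <= rad then
    if hits e (kappa * rad) J then (J.2 / rad) `^ beta else 0
  else
    let g := clamp (e - (kappa + 1) * rad) (e + (kappa + 1) * rad) in
    (g (J.1 + J.2) - g J.1) / (amin * rad).

Lemma ball_weight_ge0 kappa e rad J : 0 < rad -> 0 <= ball_weight kappa e rad J.
Proof.
move=> rad0; rewrite /ball_weight; case: (leP J.2 rad) => hJ.
  by case: ifP => // _; exact: powR_ge0.
rewrite divr_ge0 ?mulr_ge0 ?(ltW amin_gt0) ?(ltW rad0) // subr_ge0.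
by apply: clamp_homo; rewrite lerDl ltW // (lt_trans rad0).
Qed.

Lemma ball_weight_superadditive kappa e rad J l :
  0 <= kappa -> 0 < rad -> 0 < J.2 ->
  \sum_(x <- lev l) ball_weight kappa e rad (subinterval J (ivl x)) <=
    ball_weight kappa e rad J.
Proof.
move=> kappa0 rad0 J0.
have amin0 := ltW amin_gt0.
rewrite {2}/ball_weight; case: (leP J.2 rad) => hJ.
  have small x : x \in lev l -> J.2 * (ivl x).2 <= rad.
    move=> /lev_ivl[x0 xa x1]; apply: le_trans hJ.
    apply: ler_piMr; [exact: ltW | lra].
  case: ifP => [Jmeet|Jmeet]; last first.
    (* A node away from the target only has children away from it. *)
    rewrite big_seq big1 // => x xl; rewrite /ball_weight /= small //.
    case: ifP => // xmeet; move: Jmeet; rewrite /hits.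
    have [x0 xa x1] := lev_ivl _ _ xl.
    move: xmeet; rewrite /hits /= => /andP[h1 h2] /negP; case; apply/andP.
    by split; nra.
  rewrite -[leRHS]mulr1.
  apply: (le_trans _ (ler_wpM2l (powR_ge0 _ _) (lev_beta l))).
  rewrite mulr_sumr big_seq [leRHS]big_seq; apply: ler_sum => x xl.
  have [x0 xa x1] := lev_ivl _ _ xl.
  rewrite /ball_weight /= small //; case: ifP => _; last first.
    by apply: mulr_ge0; exact: powR_ge0.
  rewrite -powRM ?divr_ge0 ?(ltW J0) ?(ltW rad0) //; last by lra.
  by rewrite mulrAC.
(* Above the scale rad the increments of the monotone g are compared with the
   weights of the children, of either regime. *)
set lo := e - _; set hi := e + _; set g := clamp lo hi.
have lohi : lo <= hi by rewrite /lo /hi; nra.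
have gJ : {homo (fun s => g (J.1 + J.2 * s)) : x y / x <= y}.
  by move=> x y xy; apply: clamp_homo; rewrite lerD2l ler_pM2l.
have /= := lev_packed l gJ; rewrite mulr1 mulr0 addr0 => gl.
rewrite ler_pdivlMr ?mulr_gt0 //; apply: le_trans gl.
rewrite mulr_suml [leLHS]big_seq [leRHS]big_seq; apply: ler_sum => x xl.
have [x0 xa x1] := lev_ivl _ _ xl.
have ginc : 0 <= g (J.1 + J.2 * ((ivl x).1 + (ivl x).2)) - g (J.1 + J.2 * (ivl x).1).
  by rewrite subr_ge0; apply: gJ; lra.
rewrite -ler_pdivlMr ?mulr_gt0 // /ball_weight /=.
case: (leP (J.2 * (ivl x).2) rad) => hx; last by rewrite -/lo -/hi -/g mulrDr addrA.
case: ifP => [|_]; last by rewrite divr_ge0 // mulr_ge0 // ltW.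
move=> /andP[/= h1 h2].
(* A child that crosses the scale rad has weight at most 1, and lies in the
   window, where g is the identity. *)
rewrite (@le_trans _ _ 1) //.
  have -> : 1 = 1 `^ beta by rewrite powR1.
  apply: ge0_ler_powR => //; rewrite ?nnegrE ?divr_ge0 ?(ltW rad0) //.
    by rewrite mulr_ge0 ?ltW // (lt_le_trans amin_gt0).
  by rewrite ler_pdivrMr // mul1r.
rewrite ler_pdivlMr ?mulr_gt0 // mul1r.
rewrite /g !clamp_id; first by nra.
  by rewrite /lo /hi; apply/andP; split; nra.
by rewrite /lo /hi; apply/andP; split; nra.
Qed.

(** The Assouad-type count: the number of leaves of length about r that meet an
    interval of length about rad only depends on rad / r. *)
Lemma leaves_hitting_count kappa e rad r ls :
  0 <= kappa -> 0 < r <= rad -> rad < 1 ->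
  {in leaves r ls [::], forall w, (piece w).2 <= r} ->
  (count (fun w => hits e (kappa * rad) (piece w)) (leaves r ls [::]))%:R <=
    (2 * kappa + 2) / amin * (amin^-1 * (rad / r)) `^ beta.
Proof.
move=> kappa0 /andP[r0 rrad] rad1 leaf_r.
have rad0 : 0 < rad by exact: lt_le_trans rrad.
have inv_weight : 0 < (amin^-1 * (rad / r)) `^ beta.
  by rewrite powR_gt0 // mulr_gt0 ?invr_gt0 // divr_gt0.
have weight_root : ball_weight kappa e rad (piece [::]) <= (2 * kappa + 2) / amin.
  rewrite /ball_weight /= (lt_geF rad1) ler_pdivrMr ?mulr_gt0 //.
  rewrite mulrA divfK ?gt_eqF //.
  set lo := e - _; set hi := e + _.
  have lohi : lo <= hi by rewrite /lo /hi; nra.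
  apply: (le_trans (clamp_diff_le _ _ _ _ lohi)).
  by rewrite /lo /hi; lra.
rewrite -ler_pdivrMr //; apply: le_trans weight_root.
apply: (@le_trans _ _
  (\sum_(w <- leaves r ls [::]) ball_weight kappa e rad (piece w))).
  rewrite -sum1_count natr_sum mulr_suml big_mkcond /= big_seq [leRHS]big_seq.
  apply: ler_sum => w wl; case: ifP => wmeet; last exact: ball_weight_ge0.
  rewrite /ball_weight (le_trans (leaf_r _ wl) rrad) wmeet mul1r.
  have wge : amin * r <= (piece w).2.
    apply: leaf_ge (wl) => [l x _ /lev_ivl[]//|//|].
    rewrite /= -[leRHS]mulr1; apply: ler_pM; rewrite ?(ltW amin_gt0) ?(ltW r0) //.
    exact: ltW (le_lt_trans rrad rad1).
  have w0 : 0 <= (piece w).2 by apply: le_trans wge; rewrite mulr_ge0 ?ltW.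
  have inv0 : 0 <= amin^-1 * (rad / r) by rewrite ltW // mulr_gt0 ?invr_gt0 ?divr_gt0.
  rewrite -[leLHS]mul1r ler_pdivrMr // -powRM ?divr_ge0 ?(ltW rad0) //.
  have -> : (piece w).2 / rad * (amin^-1 * (rad / r)) = (piece w).2 / (amin * r).
    by field; rewrite !gt_eqF.
  have one_le : 1 <= (piece w).2 / (amin * r).
    by rewrite ler_pdivlMr ?mulr_gt0 // mul1r.
  by rewrite -[leLHS](powRr0 ((piece w).2 / (amin * r))) ler_powR.
apply: leaves_sum_le => w l lls rw; apply: ball_weight_superadditive => //.
exact: lt_trans rw.
Qed.

(** When sum a^beta = 1 on every level the mass length^beta is conserved from
    the root to the leaves, each of which carries at most t^beta. *)
Lemma leaves_size_ge t ls : 0 < t ->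
  (forall l, l \in ls -> \sum_(x <- lev l) (ivl x).2 `^ beta = 1) ->
  {in leaves t ls [::], forall w, 0 < (piece w).2 <= t} ->
  1 <= (size (leaves t ls [::]))%:R * t `^ beta.
Proof.
move=> t0 sum1 leaf_t.
(* With equality on each level the opposite weight is superadditive too. *)
have := @leaves_sum_le (fun J => - J.2 `^ beta) t ls [::].
rewrite /= powR1 sumrN lerN2 => /(_ _)/le_trans; apply.
  move=> w l lls tw; rewrite sumrN lerN2.
  rewrite -[leLHS]mulr1 -(sum1 l lls) mulr_sumr.
  rewrite big_seq [leRHS]big_seq; apply: ler_sum => x xl /=.
  have [x0 xa x1] := lev_ivl _ _ xl.
  by rewrite powRM // ltW // ?(lt_le_trans amin_gt0 xa) ?(lt_trans t0 tw).
rewrite -sum1_size natr_sum mulr_suml big_seq [leRHS]big_seq.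
apply: ler_sum => w wl; have /andP[w0 wt] := leaf_t _ wl.
by rewrite mul1r ge0_ler_powR // nnegrE ltW.
Qed.

End IntervalTree.
Unset Implicit Arguments.

(** Consecutive intervals on a line are packed.  The right end e is arbitrary
    for the induction: removing the last interval moves it to c_(n-1). *)
Lemma chain_increments {R : realType} {n : nat}
    (c a : 'I_n -> R) (g : R -> R) (e : R) :
  {homo g : x y / x <= y} -> 0 <= e -> (forall j, 0 <= c j) ->
  (forall j j' : 'I_n, j' = j.+1 :> nat -> c j + a j <= c j') ->
  (forall j : 'I_n, j.+1 = n -> c j + a j <= e) ->
  \sum_(j < n) (g (c j + a j) - g (c j)) <= g e - g 0.
Proof.
move=> g_homo; elim: n c a e => [|n IH] c a e e0 c0 chain last.
  by rewrite big_ord0 subr_ge0 g_homo.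
rewrite big_ord_recr /=.
pose inj := widen_ord (leqnSn n).
have H : \sum_(j < n) (g (c (inj j) + a (inj j)) - g (c (inj j))) <=
    g (c ord_max) - g 0.
  by apply: (IH (c \o inj) (a \o inj)) => //= j => [j' jj'|jn]; apply: chain.
have := g_homo _ _ (last ord_max erefl); lra.
Qed.

(** * Auxiliary facts *)

Lemma finite_lower_bound {R : realType} {T : finType} (f : T -> R) :
  (forall x, 0 < f x) -> exists2 e : R, 0 < e <= 1 & forall x, e <= f x.
Proof.
move=> f0; exists (\big[Num.min/1]_x f x); last first.
  by move=> x; apply: bigmin_le_cond.
by rewrite bigmin_le_id andbT; apply/bigmin_gtP.
Qed.

Lemma small_power {R : realType} (q e : R) : 0 <= q < 1 -> 0 < e ->
  exists k, q ^+ k <= e.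
Proof.
move=> /andP[q0 q1] e0.
have qn : `|q| < 1 by rewrite ger0_norm.
have /cvgrPdist_lt/(_ e e0)[N _ /(_ N (leqnn N))/=] := cvg_expr qn.
rewrite sub0r normrN ger0_norm ?exprn_ge0 // => /ltW qN; by exists N.
Qed.

Lemma continuous_powR_exponent {R : realType} (x : R) : 0 < x ->
  continuous (fun s : R => x `^ s).
Proof.
move=> x0; have -> : (fun s : R => x `^ s) = (fun s => expR (s * ln x)).
  by apply/funext => s; rewrite /powR gt_eqF.
move=> s; apply: continuous_comp; last exact: continuous_expR.
by apply: cvgM; [exact: cvg_id | exact: cvg_cst].
Qed.

Section EuclideanDistance.
Context {R : realType}.
Implicit Types p q : R * R.

Lemma euclid_dist_ge1 p q : `|p.1 - q.1| <= euclid_dist p q.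
Proof. by rewrite /euclid_dist -[leLHS]sqrtr_sqr ler_wsqrtr // lerDl sqr_ge0. Qed.

Lemma euclid_dist_ge2 p q : `|p.2 - q.2| <= euclid_dist p q.
Proof. by rewrite /euclid_dist -[leLHS]sqrtr_sqr ler_wsqrtr // lerDr sqr_ge0. Qed.

Lemma euclid_dist_le p q : euclid_dist p q <= `|p.1 - q.1| + `|p.2 - q.2|.
Proof.
rewrite -[leRHS]ger0_norm ?addr_ge0 // -[leRHS]sqrtr_sqr ler_wsqrtr //.
rewrite -(real_normK (num_real (p.1 - q.1))) -(real_normK (num_real (p.2 - q.2))).
by rewrite sqrrD addrAC lerDl mulrn_wge0 // mulr_ge0.
Qed.

End EuclideanDistance.

(** Coverings are built as lists of centres, possibly with repetitions. *)
Lemma covered_by_seq {R : realType} {T : eqType} (dist : T -> T -> R)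
    (X A : set T) (r N : R) (s : seq T) :
  {in s, forall z, X z} -> (size s)%:R <= N ->
  (forall p, A p -> exists2 z, z \in s & mball dist X z r p) ->
  covered_by_balls dist X A r N.
Proof.
move=> sX sN sA; exists (size s), (fun i => tnth (in_tuple s) i); split => //.
  by move=> i; apply: sX; exact: mem_tnth.
move=> p /sA[z zs zp]; have /tnthP[i zi] : z \in in_tuple s by [].
by exists i => //=; rewrite -zi.
Qed.

(** Choice of the number l of prescribed columns: since x < y, the ratio
    y^(l+k) / x^l grows geometrically from y^k < 1, and the first l at which it
    reaches 1 leaves it at most y / x. *)
Lemma comparable_powers {R : realType} (x y : R) k : 0 < x -> x < y -> y < 1 ->
  y ^+ k < 1 -> exists2 l, x ^+ l <= y ^+ (l + k) & y ^+ (l + k) <= y / x * x ^+ l.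
Proof.
move=> x0 xy y1 yk; have y0 := lt_trans x0 xy.
have exl : exists l, x ^+ l <= y ^+ (l + k).
  have q01 : 0 <= x / y < 1.
    by rewrite divr_ge0 ?(ltW x0) ?(ltW y0) //= ltr_pdivrMr // mul1r.
  have [l] := small_power (x / y) (y ^+ k) q01 (exprn_gt0 _ y0).
  by rewrite expr_div_n ler_pdivrMr ?exprn_gt0 // -exprD addnC; exists l.
case: (ex_minnP exl) => -[|l] lP lmin; first by rewrite expr0 add0n leNgt yk in lP.
exists l.+1 => //.
have /ltW lN : y ^+ (l + k) < x ^+ l.
  by rewrite ltNge; apply/negP => /lmin; rewrite ltnn.
rewrite addSn !exprS; have -> : y / x * (x * x ^+ l) = y * x ^+ l.
  by field; rewrite gt_eqF.
by rewrite ler_pM2l.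
Qed.

(** Double counting of the pairs (x, y) by the index i of a product set that
    contains them; in the lower bound i runs over the balls of a covering. *)
Lemma size_cover (T1 T2 : eqType) (s1 : seq T1) (s2 : seq T2) N
    (p : 'I_N -> pred T1) (q : 'I_N -> pred T2) :
  (forall x y, x \in s1 -> y \in s2 -> exists i, p i x && q i y) ->
  (size s1 * size s2 <= \sum_(i < N) count (p i) s1 * count (q i) s2)%N.
Proof.
move=> pq.
have countE (T : eqType) (f : pred T) s : count f s = (\sum_(x <- s) f x)%N.
  by rewrite -sum1_count big_mkcond /=; apply: eq_bigr => x _; case: (f x).
under eq_bigr => i _ do rewrite !countE big_distrlr /=.
rewrite exchange_big /= -sum1_size big_distrl /= big_seq [leqRHS]big_seq.
apply: leq_sum => x xs; rewrite mul1n exchange_big /= -sum1_size.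
rewrite big_seq [leqRHS]big_seq; apply: leq_sum => y ys.
have [i /andP[pix qiy]] := pq x y xs ys.
by rewrite (bigD1 i) //= pix qiy.
Qed.

(** The affine change of variable s |-> p + rad * s turns a ball of radius w
    into an interval of radius at most t. *)
Lemma hits_of_close {R : realType} (J : R * R) (rad t s x p w : R) :
  0 < rad -> `|x - (p + rad * s)| < w -> w <= rad * t ->
  J.1 <= s <= J.1 + J.2 -> hits ((x - p) / rad) (1 * t) J.
Proof.
move=> rad0 xs wt Js; set e := (x - p) / rad.
have xE : x = p + rad * e by rewrite /e mulrC divfK ?gt_eqF //; lra.
move: (lt_le_trans xs wt); rewrite xE opprD addrACA subrr add0r -mulrBr.
rewrite normrM gtr0_norm // ltr_pM2l // ltr_norml mul1r => es.
by rewrite /hits; lra.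
Qed.

(** Since the sum at exponent 1 is at most 1, intermediate values give a root
    beyond any exponent where the sum exceeds 1. *)
Lemma powR_sum_root {R : realType} N (f : 'I_N -> R) (s0 : R) :
  (forall j, 0 < f j < 1) -> \sum_j f j <= 1 -> 1 < \sum_j f j `^ s0 ->
  exists2 s, s0 < s & \sum_j f j `^ s = 1.
Proof.
move=> f01 f1 fs0.
pose F s := \sum_j f j `^ s.
have F1 : F 1 = \sum_j f j.
  by apply: eq_bigr => j _; rewrite powRr1 //; case/andP: (f01 j) => /ltW.
have s01 : s0 <= 1.
  rewrite leNgt; apply: contraTN fs0 => s1; rewrite -leNgt; apply: le_trans f1.
  rewrite -F1; apply: ler_sum => j _; apply: ger_powR; last exact: ltW.
  by case/andP: (f01 j) => -> /ltW.
have Fcont : continuous F.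
  apply: continuous_big => [|j _]; first exact: add_continuous.
  by apply: continuous_powR_exponent; case/andP: (f01 j).
have [||s ss Fs] := @IVT R F s0 1 1 s01.
- exact: continuous_subspaceT.
- by rewrite ge_min le_max (ltW fs0) /= F1 f1 orbT.
- exists s => //; rewrite lt_neqAle; move: ss; rewrite in_itv /= => /andP[-> _].
  by rewrite andbT; apply: contraTneq fs0 => ->; rewrite -/(F s) Fs ltxx.
Qed.

(** * Coding of the carpet *)

Section Carpet.
Context {R : realType} {m : nat} {n : 'I_m -> nat}.
Variables (a c : forall i : 'I_m, 'I_(n i) -> R) (b d : 'I_m -> R).
Variable S : set (R * R).
Hypothesis hn : forall i, (1 <= n i)%N.
Hypothesis hab :
  forall (i : 'I_m) (j : 'I_(n i)), 0 < a i j /\ a i j < b i /\ b i < 1.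
Hypothesis hd01 : forall i, 0 <= d i < 1.
Hypothesis hdb : forall i i' : 'I_m, i' = i.+1 :> nat -> d i + b i <= d i'.
Hypothesis hdlast : forall i : 'I_m, i.+1 = m -> d i + b i <= 1.
Hypothesis hc01 : forall (i : 'I_m) (j : 'I_(n i)), 0 <= c i j < 1.
Hypothesis hca : forall (i : 'I_m) (j j' : 'I_(n i)),
  j' = j.+1 :> nat -> c i j + a i j <= c i j'.
Hypothesis hclast :
  forall (i : 'I_m) (j : 'I_(n i)), j.+1 = n i -> c i j + a i j <= 1.
Hypothesis hS : is_limit_set a c b d S.

Local Notation digit := {i : 'I_m & 'I_(n i)}.

Definition xivl (x : digit) : R * R := (c (tag x) (tagged x), a (tag x) (tagged x)).
Definition yivl (i : 'I_m) : R * R := (d i, b i).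
Definition xlev (i : 'I_m) : seq digit :=
  [seq (Tagged (fun i => 'I_(n i)) j : digit) | j <- enum 'I_(n i)].
Definition ylev (_ : unit) : seq 'I_m := enum 'I_m.

Definition code (w : seq digit) (z : R * R) : R * R :=
  foldr (fun x => carpet_map a c b d (tagged x)) z w.

Definition rows (w : seq digit) : seq 'I_m := map tag w.

Lemma code1 w z : (code w z).1 = (piece xivl w).1 + (piece xivl w).2 * z.1.
Proof.
elim/last_ind: w z => [|w x IH] z; first by rewrite /= mul1r add0r.
by rewrite /code foldr_rcons -/(code _ _) IH piece_rcons /=; ring.
Qed.

Lemma code2 w z : (code w z).2 =
  (piece yivl (rows w)).1 + (piece yivl (rows w)).2 * z.2.
Proof.
elim/last_ind: w z => [|w x IH] z; first by rewrite /= mul1r add0r.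
by rewrite /code foldr_rcons -/(code _ _) IH /rows map_rcons piece_rcons /=; ring.
Qed.

Lemma code_cat v w z : code (v ++ w) z = code v (code w z).
Proof. by rewrite /code foldr_cat. Qed.

Lemma S_carpet_map i (j : 'I_(n i)) z : S z -> S (carpet_map a c b d j z).
Proof.
by move=> Sz; have [_ _ ->] := hS; exists i => //; exists j => //; exists z.
Qed.

Lemma code_S w z : S z -> S (code w z).
Proof. by move=> Sz; elim: w => //= x w; exact: S_carpet_map. Qed.

Lemma S_preimage z : S z ->
  exists (x : digit), exists2 z', S z' & z = carpet_map a c b d (tagged x) z'.
Proof.
have [_ _ hSE] := hS; rewrite {1}hSE => -[i _ [j _ [z' Sz' <-]]].
by exists (Tagged (fun i => 'I_(n i)) j), z'.
Qed.

(** Every point of S has codes of any length.  A single word w serves for all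
    its prefixes, because leaves are prefixes of a length unknown beforehand. *)
Lemma S_code k z : S z -> exists2 w, size w = k &
  forall h, exists2 z', S z' & z = code (take h w) z'.
Proof.
move=> Sz; suff: exists2 w, size w = k &
    (forall h, (h <= k)%N -> exists2 z', S z' & z = code (take h w) z').
  move=> [w wk H]; exists w => // h; have [/H//|kh] := leqP h k.
  by rewrite take_oversize ?wk ?(ltnW kh) // -(take_size w) wk; exact: H.
elim: k => [|k [w wk IH]].
  by exists [::] => // h _; exists z.
have [z' Sz' zE] := IH k (leqnn k).
have [x [z'' Sz'' z'E]] := S_preimage _ Sz'.
exists (rcons w x); first by rewrite size_rcons wk.
move=> h; rewrite leq_eqVlt => /predU1P[->|]; last first.
  rewrite ltnS => hk; have [y Sy ->] := IH h hk; exists y => //.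
  by rewrite -cats1 takel_cat ?wk.
exists z'' => //; rewrite take_oversize ?size_rcons ?wk //.
rewrite /code foldr_rcons -/(code _ _) zE take_oversize ?wk //.
by rewrite z'E.
Qed.

Lemma b_gt0 i : 0 < b i.
Proof. by have [a0 [ab _]] := hab i (Ordinal (hn i)); exact: lt_trans ab. Qed.

Lemma b_lt1 i : b i < 1.
Proof. by have [_ []] := hab i (Ordinal (hn i)). Qed.

Lemma d_b_le1 i : d i + b i <= 1.
Proof.
have [im|mi] := ltnP i.+1 m; last first.
  by apply: hdlast; apply/eqP; rewrite eqn_leq mi ltn_ord.
apply: le_trans (hdb i (Ordinal im) erefl) _.
by have /andP[_ /ltW] := hd01 (Ordinal im).
Qed.

Lemma c_a_le1 i (j : 'I_(n i)) : c i j + a i j <= 1.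
Proof.
have [jn|nj] := ltnP j.+1 (n i); last first.
  by apply: hclast; apply/eqP; rewrite eqn_leq nj ltn_ord.
apply: le_trans (hca i j (Ordinal jn) erefl) _.
by have /andP[_ /ltW] := hc01 i (Ordinal jn).
Qed.

(** At a point of S where a coordinate is extremal, the preimage of this point
    under one of the maps gives an inequality M <= a M + c with c + a <= 1, so
    M <= 1; similarly for minima. *)
Lemma S_unit_square z : S z -> (0 <= z.1 <= 1) /\ (0 <= z.2 <= 1).
Proof.
have [S0 Scompact _] := hS.
have c1 : {within S, continuous (fst : R * R -> R)}.
  by apply: continuous_subspaceT => ? ; exact: cvg_fst.
have c2 : {within S, continuous (snd : R * R -> R)}.
  by apply: continuous_subspaceT => ? ; exact: cvg_snd.
have [M1 /set_mem SM1 leM1] := compact_EVT_max S0 Scompact c1.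
have [M2 /set_mem SM2 leM2] := compact_EVT_max S0 Scompact c2.
have [N1 /set_mem SN1 leN1] := compact_EVT_min S0 Scompact c1.
have [N2 /set_mem SN2 leN2] := compact_EVT_min S0 Scompact c2.
move=> Sz; move: (leM1 z (mem_set Sz)) (leM2 z (mem_set Sz)).
move: (leN1 z (mem_set Sz)) (leN2 z (mem_set Sz)).
have M11 : M1.1 <= 1.
  have [[i j] [z' Sz' E]] := S_preimage _ SM1; have := leM1 _ (mem_set Sz').
  rewrite E /= => h; have := c_a_le1 i j; have [a0 [ab b1]] := hab i j.
  rewrite E /= in leM1; nra.
have M21 : M2.2 <= 1.
  have [[i j] [z' Sz' E]] := S_preimage _ SM2; have := leM2 _ (mem_set Sz').
  rewrite E /= => h; have := d_b_le1 i; have := b_gt0 i; have := b_lt1 i; nra.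
have N10 : 0 <= N1.1.
  have [[i j] [z' Sz' E]] := S_preimage _ SN1; have := leN1 _ (mem_set Sz').
  rewrite E /= => h; have /andP[h0 h1] := hc01 i j.
  by have [a0 [ab b1]] := hab i j; nra.
have N20 : 0 <= N2.2.
  have [[i j] [z' Sz' E]] := S_preimage _ SN2; have := leN2 _ (mem_set Sz').
  rewrite E /= => h; have /andP[h0 h1] := hd01 i.
  by have := b_gt0 i; have := b_lt1 i; nra.
lra.
Qed.

Lemma xlevP i (x : digit) : x \in xlev i -> tag x = i.
Proof. by move=> /mapP[j _ ->]. Qed.

Lemma mem_xlev (x : digit) : x \in xlev (tag x).
Proof. by case: x => i j; apply: map_f; rewrite mem_enum. Qed.

Lemma xlev_sum (f : digit -> R) i :
  \sum_(x <- xlev i) f x = \sum_(j < n i) f (Tagged (fun i => 'I_(n i)) j).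
Proof. by rewrite big_map big_enum. Qed.

Lemma ylev_sum (f : 'I_m -> R) l : \sum_(i <- ylev l) f i = \sum_(i < m) f i.
Proof. by rewrite big_enum. Qed.

Lemma xlev_packed i : packed xivl (xlev i).
Proof.
move=> g g_homo; rewrite xlev_sum; apply: chain_increments => //.
- by move=> j; have /andP[] := hc01 i j.
- exact: hca.
- exact: hclast.
Qed.

Lemma ylev_packed l : packed yivl (ylev l).
Proof.
move=> g g_homo; rewrite ylev_sum; apply: chain_increments => //.
by move=> i; have /andP[] := hd01 i.
Qed.

Lemma xlev_ivl amin (x : digit) i : amin <= a (tag x) (tagged x) -> x \in xlev i ->
  [/\ 0 <= (xivl x).1, amin <= (xivl x).2 & (xivl x).1 + (xivl x).2 <= 1].
Proof.
by move=> ? _; split => //; [have /andP[] := hc01 _ (tagged x) | exact: c_a_le1].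
Qed.

Lemma ylev_ivl amin i l : amin <= b i -> i \in ylev l ->
  [/\ 0 <= (yivl i).1, amin <= (yivl i).2 & (yivl i).1 + (yivl i).2 <= 1].
Proof. by move=> ? _; split => //; [have /andP[] := hd01 i | exact: d_b_le1]. Qed.

Lemma contraction_bounds : exists amin bmax : R,
  [/\ 0 < amin <= 1, forall i j, amin <= a i j, forall i, amin <= b i,
     0 <= bmax < 1 & forall i, b i <= bmax].
Proof.
have [amin amin01 amin_le] := finite_lower_bound
  (fun x : digit => a (tag x) (tagged x)) (fun x => (hab _ (tagged x)).1).
have b_gap i : 0 < 1 - b i by rewrite subr_gt0 b_lt1.
have [gap gap01 gap_le] := finite_lower_bound _ b_gap.
exists amin, (1 - gap); split => //.
- by move=> i j; exact: (amin_le (Tagged (fun i => 'I_(n i)) j)).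
- move=> i; pose j := Ordinal (hn i); have [_ [/ltW + _]] := hab i j.
  by apply: le_trans; exact: (amin_le (Tagged (fun i => 'I_(n i)) j)).
- by apply/andP; split; lra.
- by move=> i; have := gap_le i; lra.
Qed.

Lemma in_piece (r : R) (J : R * R) s : J.2 <= r -> 0 <= J.2 -> 0 <= s <= 1 ->
  J.1 <= J.1 + J.2 * s <= J.1 + r.
Proof. by move=> Jr J0 /andP[s0 s1]; rewrite lerDl mulr_ge0 //= lerD2l; nra. Qed.

Lemma S_diameter_le : (diameter euclid_dist S <= 2%:E)%E.
Proof.
apply: ge_ereal_sup => _ [p [q [Sp Sq ->]]]; rewrite lee_fin.
apply: le_trans (euclid_dist_le p q) _.
have [/andP[p0 p1] /andP[p2 p3]] := S_unit_square _ Sp.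
have [/andP[q0 q1] /andP[q2 q3]] := S_unit_square _ Sq.
have h1 : `|p.1 - q.1| <= 1 by rewrite ler_norml; lra.
have h2 : `|p.2 - q.2| <= 1 by rewrite ler_norml; lra.
lra.
Qed.

(** The images of one point under maps of the first two rows have different
    ordinates: they could agree only on the common edge of the two rows, which
    comes from ordinate 1 in the first row and 0 in the second. *)
Lemma S_diameter_ge : (2 <= m)%N ->
  exists2 delta : R, 0 < delta & (delta%:E <= diameter euclid_dist S)%E.
Proof.
move=> m2; have [[z Sz] _ _] := hS.
pose i0 := Ordinal (ltnW m2); pose i1 := Ordinal m2.
pose p := carpet_map a c b d (Ordinal (hn i0)) z.
pose q := carpet_map a c b d (Ordinal (hn i1)) z.
exists (q.2 - p.2).
  have [_ /andP[z0 z1]] := S_unit_square _ Sz; rewrite /p /q /=.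
  have := hdb i0 i1 erefl; have := b_gt0 i0; have := b_gt0 i1; nra.
apply: (@le_trans _ _ (euclid_dist q p)%:E).
  by rewrite lee_fin (le_trans _ (euclid_dist_ge2 _ _)) // ler_norm.
by apply: ereal_sup_ubound; exists q, p; split => //; exact: S_carpet_map.
Qed.

(** * Counting pieces at a given scale *)

Section Exponent.
Variables (betax betay amin : R).
Hypothesis betax_ge0 : 0 <= betax.
Hypothesis betay_ge0 : 0 <= betay.
Hypothesis xsum : forall i, \sum_(j < n i) a i j `^ betax <= 1.
Hypothesis ysum : \sum_(i < m) b i `^ betay = 1.
Hypothesis amin01 : 0 < amin <= 1.
Hypothesis amin_a : forall i j, amin <= a i j.
Hypothesis amin_b : forall i, amin <= b i.

(** The vertical tree has the same level repeated; the horizontal tree over the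
    row word u has the k-th row of u as its k-th level. *)
Definition xleaves r (u : seq 'I_m) := leaves xivl xlev r u [::].
Definition yleaves r k := leaves yivl ylev r (nseq k tt) [::].

(** Here a_(ij) < b_i enters: over a row word of height at most r, full
    horizontal branches have width at most r. *)
Lemma xleaves_le r u : (piece yivl u).2 <= r ->
  {in xleaves r u, forall v, (piece xivl v).2 <= r}.
Proof.
move=> ur v; apply: (@leaf_le _ _ _ _ _ b) => //=.
- by move=> i; exact: ltW (b_gt0 i).
- move=> i x _ /xlevP <-; have [-> [/ltW -> _]] := hab _ (tagged x); exact: isT.
- by rewrite mul1r; move: ur; rewrite piece_ratio.
Qed.

Lemma yleaves_le r k bmax : 0 <= bmax -> (forall i, b i <= bmax) ->
  bmax ^+ k <= r -> {in yleaves r k, forall u, (piece yivl u).2 <= r}.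
Proof.
move=> bmax0 b_le kr u; apply: (@leaf_le _ _ _ _ _ (fun=> bmax)) => //=.
- by move=> _ i _ _; rewrite b_gt0 b_le.
- by rewrite mul1r big_const_seq count_nseq mul1n iter_mulr_1.
Qed.

Lemma xleaves_count (kappa e rad r : R) u :
  0 <= kappa -> 0 < r <= rad -> rad < 1 -> (piece yivl u).2 <= r ->
  (count (fun v => hits e (kappa * rad) (piece xivl v)) (xleaves r u))%:R <=
    (2 * kappa + 2) / amin * (amin^-1 * (rad / r)) `^ betax.
Proof.
move=> kappa0 rrad rad1 ur; have /andP[amin0 amin1] := amin01.
apply: leaves_hitting_count => //.
- by move=> i x; apply: xlev_ivl.
- exact: xlev_packed.
- by move=> i; rewrite xlev_sum.
- exact: xleaves_le.
Qed.

Lemma yleaves_count (kappa e rad r : R) k bmax :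
  0 <= bmax -> (forall i, b i <= bmax) ->
  0 <= kappa -> 0 < r <= rad -> rad < 1 -> bmax ^+ k <= r ->
  (count (fun u => hits e (kappa * rad) (piece yivl u)) (yleaves r k))%:R <=
    (2 * kappa + 2) / amin * (amin^-1 * (rad / r)) `^ betay.
Proof.
move=> bmax0 b_le kappa0 rrad rad1 kr; have /andP[amin0 amin1] := amin01.
apply: leaves_hitting_count => //.
- by move=> l i; apply: ylev_ivl.
- exact: ylev_packed.
- by move=> i; rewrite ylev_sum ysum.
- exact: yleaves_le kr.
Qed.

Lemma xpiece_gt0 v : 0 < (piece xivl v).2.
Proof. by rewrite piece_ratio prodr_gt0 // => x _; have [] := hab _ (tagged x). Qed.

Lemma ypiece_gt0 u : 0 < (piece yivl u).2.
Proof. by rewrite piece_ratio prodr_gt0 // => i _; exact: b_gt0. Qed.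

(** A code of the point is first cut where its height drops to r, then the
    resulting digit word is cut where its width drops to r. *)
Lemma S_in_leaves r k bmax z : 0 <= bmax -> (forall i, b i <= bmax) ->
  bmax ^+ k <= r -> S z ->
  exists u v, [/\ u \in yleaves r k, v \in xleaves r u,
    (piece xivl v).1 <= z.1 <= (piece xivl v).1 + (piece xivl v).2 &
    (piece yivl u).1 <= z.2 <= (piece yivl u).1 + (piece yivl u).2].
Proof.
move=> bmax0 b_le kr Sz.
have [w wk wz] := S_code k _ Sz.
have w_levels : all2 (fun l i => i \in ylev l) (nseq k tt) (rows w).
  rewrite all2E size_nseq size_map wk eqxx /=.
  by apply/allP => -[l i] _ /=; rewrite mem_enum.
have [h /=] := prefix_is_leaf yivl ylev r _ [::] _ w_levels.
rewrite -/(yleaves r k) => uleaf; set u := take h (rows w) in uleaf.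
have uE : u = rows (take h w) by rewrite /u /rows map_take.
have u_levels : all2 (fun i x => x \in xlev i) u (take h w).
  by rewrite uE; elim: (take h w) => //= x s ->; rewrite mem_xlev.
have [h' /=] := prefix_is_leaf xivl xlev r _ [::] _ u_levels.
rewrite -/(xleaves r u) => vleaf.
exists u, (take h' (take h w)); split => //.
  have [z' Sz' ->] := wz (minn h' h); rewrite take_min code1.
  by apply: in_piece (S_unit_square _ Sz').1; rewrite ?lexx ?ltW ?xpiece_gt0.
have [z' Sz' ->] := wz h; rewrite code2 -uE.
by apply: in_piece (S_unit_square _ Sz').2; rewrite ?lexx ?ltW ?ypiece_gt0.
Qed.

(** * Upper bound *)

(** The constants 8 and 4 below make the scale rad = rho / 8 smaller than 1
    (as rho <= 2 diam S <= 4), keep s = r / 4 <= rad, and make a square of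
    side s have a diameter smaller than r. *)
Lemma S_assouad_exponent : assouad_exponent euclid_dist S (betax + betay).
Proof.
have /andP[amin0 amin1] := amin01.
have [_ [bmax [_ _ _ bmax01 b_le]]] := contraction_bounds.
have /andP[bmax0 bmax1] := bmax01.
pose K : R := (2 * 8 + 2) / amin.
have K0 : 0 < K by rewrite divr_gt0 //; lra.
pose L : R := amin^-1 / 2.
have L0 : 0 < L by rewrite divr_gt0 // invr_gt0.
exists (K ^+ 2 * L `^ (betax + betay)).
  by rewrite mulr_gt0 ?exprn_gt0 ?powR_gt0.
move=> r rho r0 r_rho rho_diam x Sx.
have rho4 : rho <= 4.
  have := le_trans rho_diam S_diameter_le; rewrite lee_fin; lra.
have rho0 : 0 < rho by lra.
pose rad := rho / 8; pose s := r / 4.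
have s_rad : 0 < s <= rad by rewrite /s /rad; apply/andP; split; lra.
have rad1 : rad < 1 by rewrite /rad; lra.
have [k ks] := small_power bmax s bmax01 (andP s_rad).1.
pose U := [seq u <- yleaves s k | hits x.2 (8 * rad) (piece yivl u)].
pose V u := [seq v <- xleaves s u | hits x.1 (8 * rad) (piece xivl v)].
pose cells := [seq (v, u) | u <- U, v <- V u].
pose cell (vu : seq digit * seq 'I_m) := [set z | [/\ S z,
  (piece xivl vu.1).1 <= z.1 <= (piece xivl vu.1).1 + s &
  (piece yivl vu.2).1 <= z.2 <= (piece yivl vu.2).1 + s]].
(* An empty cell gets the centre x, which is a point of S anyway. *)
pose centre vu := xget x (cell vu).
have scaleE : amin^-1 * (rad / s) = L * (rho / r).
  by rewrite /L /s /rad; field; rewrite !gt_eqF.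
have card_U : (size U)%:R <= K * (L * (rho / r)) `^ betay.
  by rewrite size_filter -scaleE; apply: yleaves_count ks.
have card_V u : u \in U -> (size (V u))%:R <= K * (L * (rho / r)) `^ betax.
  rewrite mem_filter => /andP[_ uleaf].
  rewrite size_filter -scaleE; apply: xleaves_count => //.
  exact: (yleaves_le _ _ _ bmax0 b_le ks _ uleaf).
apply: (@covered_by_seq _ _ _ _ _ _ _ [seq centre vu | vu <- cells]).
- move=> _ /mapP[vu _ ->]; rewrite /centre.
  by case: xgetP => [z _ []|_].
- rewrite size_map size_allpairs_dep sumnE big_map natr_sum.
  apply: (@le_trans _ _ (\sum_(u <- U) K * (L * (rho / r)) `^ betax)).
    by rewrite big_seq [leRHS]big_seq; apply: ler_sum.
  rewrite big_const_seq count_predT iter_addr_0 -mulr_natl.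
  apply: (@le_trans _ _
    (K * (L * (rho / r)) `^ betay * (K * (L * (rho / r)) `^ betax))).
    by rewrite ler_wpM2r // mulr_ge0 ?powR_ge0 // ltW.
  have rr : 0 < rho / r by rewrite divr_gt0.
  have Lrr : L * (rho / r) != 0 by rewrite gt_eqF // mulr_gt0.
  rewrite -[leRHS]mulrA -powRM ?(ltW L0) ?(ltW rr) // powRD ?Lrr ?implybT //.
  by lra.
- move=> z [Sz xz].
  have [u [v [uleaf vleaf zv zu]]] := S_in_leaves _ _ _ _ bmax0 b_le ks Sz.
  have us := yleaves_le _ _ _ bmax0 b_le ks _ uleaf.
  have vs := xleaves_le _ _ us _ vleaf.
  have x1 := le_lt_trans (euclid_dist_ge1 _ _) xz.
  have x2 := le_lt_trans (euclid_dist_ge2 _ _) xz.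
  have uU : u \in U.
    rewrite mem_filter uleaf andbT /hits /rad; move: x2; rewrite ltr_norml; lra.
  have vV : v \in V u.
    rewrite mem_filter vleaf andbT /hits /rad; move: x1; rewrite ltr_norml; lra.
  have zcell : cell (v, u) z by split => //=; lra.
  exists (centre (v, u)).
    by apply: map_f; apply/allpairsPdep; exists u, v.
  have [Sc c1 c2] : cell (v, u) (centre (v, u)) by apply: xgetPex; exists z.
  split => //; apply: le_lt_trans (euclid_dist_le _ _) _.
  have h1 : `|(centre (v, u)).1 - z.1| <= s by rewrite ler_norml; lra.
  have h2 : `|(centre (v, u)).2 - z.2| <= s by rewrite ler_norml; lra.
  by rewrite /s in h1 h2; lra.
Qed.

(** * Lower bound *)

Definition lift (u : seq 'I_m) : seq digit :=
  [seq Tagged (fun i => 'I_(n i)) (Ordinal (hn i)) | i <- u].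

Lemma rows_lift u : rows (lift u) = u.
Proof. by rewrite /rows -map_comp map_id_in. Qed.

(** The approximate square is the part of S whose code starts with l copies of
    the digit e = (i0, 0), followed by k digits in the row i0.  For v a
    horizontal leaf and u a vertical leaf, the point [pt v u] has a code that
    starts with e^l v, padded with e up to length l + k, and continues with the
    row word u.  So its abscissa is controlled by v alone and its ordinate by u
    alone, and [size_cover] compares the number of pairs with the number of
    balls. *)
Lemma exponent_lower_bound i0 alpha : (2 <= m)%N ->
  \sum_(j < n i0) a i0 j `^ betax = 1 -> 0 < alpha ->
  assouad_exponent euclid_dist S alpha ->
  exists2 M : R, 0 < M &
    forall t, 0 < t < 1 -> 1 <= M * t `^ (betax + betay - alpha).
Proof.
move=> m2 xsum_i0 alpha0 [C C0 cover].
have /andP[amin0 amin1] := amin01.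
have [_ [bmax [_ _ _ bmax01 b_le]]] := contraction_bounds.
have /andP[bmax0 bmax1] := bmax01.
have [[z0 Sz0] _ _] := hS.
have [delta delta0 delta_le] := S_diameter_ge m2.
pose j0 := Ordinal (hn i0); pose e := Tagged (fun i => 'I_(n i)) j0 : digit.
have [A0 [AB B1]] := hab i0 j0; set A := a i0 j0 in A0 AB; set B := b i0 in AB B1.
have B0 : 0 < B by exact: lt_trans AB.
pose K beta : R := (2 * 1 + 2) / amin * (amin^-1 * 1) `^ beta.
have K0 beta : 0 < K beta.
  by rewrite /K mulr_gt0 ?powR_gt0 ?divr_gt0 ?mulr_gt0 ?invr_gt0 //; lra.
pose L : R := 2 * (1 + B / A).
have L0 : 0 < L by rewrite /L mulr_gt0 // addr_gt0 // divr_gt0.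
exists (C * L `^ alpha * (K betax * K betay)).
  by apply: mulr_gt0; apply: mulr_gt0 => //; exact: powR_gt0.
move=> t t01; have /andP[t0 t1] := t01.
(* k levels are enough to reach the relative scale t, and make the rectangle
   small compared with the diameter of S. *)
have B01 : 0 <= B < 1 by rewrite (ltW B0).
have min_gt0 : 0 < Num.min t (delta / 2) by rewrite lt_min t0 divr_gt0.
have [k] := small_power _ _ B01 min_gt0.
rewrite le_min => /andP[kt kdelta].
have [k' k't] := small_power bmax t bmax01 t0.
have [l Al Hl] := comparable_powers A B k A0 AB B1 (le_lt_trans kt t1).
(* The rectangle has width rad and height H, with rad <= H <= B / A * rad. *)
set rad := A ^+ l in Al Hl; set H := B ^+ (l + k) in Al Hl.
have rad0 : 0 < rad by rewrite exprn_gt0.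
have H0 : 0 < H by rewrite exprn_gt0.
pose X := xleaves t (nseq k i0); pose Y := yleaves t k'.
have yk : (piece yivl (nseq k i0)).2 = B ^+ k.
  by rewrite piece_nseq_ratio.
have X_le : {in X, forall v, (piece xivl v).2 <= t}.
  by apply: xleaves_le; rewrite yk.
have Y_le := yleaves_le t k' bmax bmax0 b_le k't.
have X_size : 1 <= (size X)%:R * t `^ betax.
  apply: (leaves_size_ge _ _ _ amin0 _ _ betax_ge0 _ _ t0) => [i x|i|v vX].
  - by apply: xlev_ivl.
  - by rewrite mem_nseq => /andP[_ /eqP->]; rewrite xlev_sum.
  - by rewrite xpiece_gt0 X_le.
have Y_size : 1 <= (size Y)%:R * t `^ betay.
  apply: (leaves_size_ge _ _ _ amin0 _ _ betay_ge0 _ _ t0) => [? i|? _|u uY].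
  - by apply: ylev_ivl.
  - by rewrite ylev_sum.
  - by rewrite ypiece_gt0 Y_le.
pose pad v := nseq l e ++ v ++ nseq (k - size v) e.
pose pt v u := code (pad v ++ lift u) z0.
have pad_rows v : v \in X -> rows (pad v) = nseq (l + k) i0.
  move=> /leaves_letters[v' [/= ->]]; rewrite size_nseq => vk v_i0.
  rewrite /pad /rows !map_cat !map_nseq nseqD -/(rows v'); congr (_ ++ _).
  have /all_pred1P -> : all (pred1 i0) (rows v').
    apply/allP => _ /mapP[x /v_i0[i + /xlevP->] ->].
    by rewrite mem_nseq => /andP[].
  by rewrite size_map -nseqD subnKC.
pose px := (piece xivl (nseq l e)).1; pose py := (piece yivl (nseq (l + k) i0)).1.
have pxE : (piece xivl (nseq l e)).2 = rad.
  by rewrite piece_nseq_ratio.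
have pyE : (piece yivl (nseq (l + k) i0)).2 = H.
  by rewrite piece_nseq_ratio.
have pt1 v u : exists2 s, (pt v u).1 = px + rad * s &
    0 <= s <= 1 /\ (piece xivl v).1 <= s <= (piece xivl v).1 + (piece xivl v).2.
  rewrite /pt /pad -!catA 2!code_cat code1 pxE.
  set z := code (_ ++ _) z0; have Sz : S z by exact: code_S.
  exists (code v z).1 => //; split; first exact: (S_unit_square _ (code_S _ _ Sz)).1.
  rewrite code1; apply: in_piece (S_unit_square _ Sz).1 => //.
  exact/ltW/xpiece_gt0.
have pt2 v u : v \in X -> exists2 s, (pt v u).2 = py + H * s &
    0 <= s <= 1 /\ (piece yivl u).1 <= s <= (piece yivl u).1 + (piece yivl u).2.
  move=> vX; rewrite /pt code_cat code2 pad_rows // pyE.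
  exists (code (lift u) z0).2 => //.
  split; first exact: (S_unit_square _ (code_S _ _ Sz0)).2.
  rewrite code2 rows_lift; apply: in_piece (S_unit_square _ Sz0).2 => //.
  exact/ltW/ypiece_gt0.
pose x0 := code (nseq (l + k) e) z0.
have [s0 x01 /andP[s00 s01]] : exists2 s, x0.1 = px + rad * s & 0 <= s <= 1.
  rewrite /x0 nseqD code_cat code1 pxE.
  exists (code (nseq k e) z0).1 => //.
  exact: (S_unit_square _ (code_S _ _ Sz0)).1.
have x02 : x0.2 = py + H * z0.2.
  by rewrite /x0 code2 /rows map_nseq pyE.
have [_ /andP[z00 z01]] := S_unit_square _ Sz0.
have rho_ge : rad * t <= 2 * (rad + H) / 2 by nra.
have rho_diam : ((2 * (rad + H) / 2)%:E <= diameter euclid_dist S)%E.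
  apply: le_trans delta_le; rewrite lee_fin.
  suff : H <= delta / 2 by lra.
  apply: le_trans kdelta; rewrite /H exprD; apply: ler_piMl.
    by rewrite exprn_ge0 // ltW.
  by rewrite exprn_ile1 // ltW.
have [N [z [zS zN zcov]]] :=
  cover _ _ (mulr_gt0 rad0 t0) rho_ge rho_diam x0 (code_S _ _ Sz0).
pose p (i : 'I_N) v := hits (((z i).1 - px) / rad) (1 * t) (piece xivl v).
pose q (i : 'I_N) u := hits (((z i).2 - py) / H) (1 * t) (piece yivl u).
have XY_cover v u : v \in X -> u \in Y -> exists i, p i v && q i u.
  move=> vX uY; have [s1 E1 [/andP[s10 s11] vs1]] := pt1 v u.
  have [s2 E2 [/andP[s20 s21] us2]] := pt2 v u vX.
  have [|i _ [_ izt]] := zcov (pt v u).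
    split; first exact: code_S.
    apply: le_lt_trans (euclid_dist_le _ _) _; rewrite E1 E2 x01 x02.
    have h1 : `|px + rad * s0 - (px + rad * s1)| <= rad by rewrite ler_norml; nra.
    have h2 : `|py + H * z0.2 - (py + H * s2)| <= H by rewrite ler_norml; nra.
    lra.
  exists i; apply/andP; split.
    apply: hits_of_close (lexx (rad * t)) vs1 => //; rewrite -E1.
    exact: le_lt_trans (euclid_dist_ge1 _ _) izt.
  apply: hits_of_close (ler_wpM2r (ltW t0) Al) us2 => //; rewrite -E2.
  exact: le_lt_trans (euclid_dist_ge2 _ _) izt.
(* Each ball meets boundedly many leaves: this is the count at rad = r = t. *)
have unit_scale : amin^-1 * 1 = amin^-1 * (t / t) by rewrite divff ?gt_eqF.
have count_p i : (count (p i) X)%:R <= K betax.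
  rewrite /K unit_scale; apply: xleaves_count => //.
    by rewrite t0 lexx.
  by rewrite yk.
have count_q i : (count (q i) Y)%:R <= K betay.
  rewrite /K unit_scale; apply: yleaves_count b_le _ _ _ k't => //.
  by rewrite t0 lexx.
have XY_size : (size X)%:R * (size Y)%:R <= N%:R * (K betax * K betay).
  rewrite -natrM; apply: (@le_trans _ _
    (\sum_(i < N) count (p i) X * count (q i) Y)%:R).
    by rewrite ler_nat; exact: size_cover.
  rewrite natr_sum -[N in leRHS]card_ord -sum1_card natr_sum mulr_suml.
  by apply: ler_sum => i _; rewrite mul1r natrM ler_pM.
have ratio_le : 2 * (rad + H) / (rad * t) <= L / t.
  rewrite ler_pdivrMr ?mulr_gt0 //.
  have -> : L / t * (rad * t) = 2 * (rad + B / A * rad).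
    by rewrite /L; field; rewrite !gt_eqF.
  by rewrite ler_pM2l // lerD2l.
have ratio_gt0 : 0 < 2 * (rad + H) / (rad * t).
  by rewrite divr_gt0 ?mulr_gt0 // addr_gt0.
have N_le : N%:R <= C * (L / t) `^ alpha.
  apply: le_trans zN _; rewrite ler_wpM2l ?(ltW C0) //.
  apply: ge0_ler_powR ratio_le; rewrite ?nnegrE; first exact: ltW.
    exact: ltW.
  by rewrite ltW // divr_gt0.
have := ler_pM ler01 ler01 X_size Y_size.
rewrite mulr1 mulrACA => /le_trans; apply.
apply: (@le_trans _ _ (C * (L / t) `^ alpha * (K betax * K betay) *
  (t `^ betax * t `^ betay))).
  rewrite ler_wpM2r ?mulr_ge0 ?powR_ge0 //; apply: le_trans XY_size _.
  by rewrite ler_wpM2r // mulr_ge0 // ltW.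
rewrite -powRD ?(gt_eqF t0) ?implybT //.
have tinv : t^-1 `^ alpha = (t `^ alpha)^-1.
  by rewrite -(powR_inv1 (ltW t0)) -powRrM mulN1r powRN.
rewrite powRB ?(gt_eqF t0) ?implybT // powRM ?invr_ge0 ?(ltW t0) ?(ltW L0) // tinv.
by lra.
Qed.

(** If alpha were smaller, t with t^(betax + betay - alpha) = 1 / (M + 1) would
    contradict the previous bound. *)
Lemma exponent_ge i0 alpha : (2 <= m)%N ->
  \sum_(j < n i0) a i0 j `^ betax = 1 -> 0 < alpha ->
  assouad_exponent euclid_dist S alpha -> betax + betay <= alpha.
Proof.
move=> m2 xsum_i0 alpha0 exponent.
have [M M0 H] := exponent_lower_bound i0 alpha m2 xsum_i0 alpha0 exponent.
rewrite -subr_le0 leNgt; apply/negP; set gap := betax + betay - alpha => gap0.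
pose t := (M + 1)^-1 `^ gap^-1.
have M1 : 0 < (M + 1)^-1 < 1 by rewrite invr_gt0 invf_lt1; lra.
have /andP[M10 M11] := M1.
have t0 : 0 < t by rewrite powR_gt0.
have t_gap : t `^ gap = (M + 1)^-1.
  by rewrite -powRrM mulVf ?gt_eqF // powRr1 // ltW.
have t1 : t < 1.
  rewrite ltNge; apply/negP => t1; have := ge0_ler_powR (ltW gap0) _ _ t1.
  rewrite powR1 t_gap !nnegrE ler01 (ltW t0) => /(_ isT isT); lra.
have := H t; rewrite t0 t1 t_gap => /(_ isT).
by rewrite ler_pdivlMr; lra.
Qed.

End Exponent.

(** * The maximal exponent of the rows *)

(** A row with a sum larger than 1 would have a root larger than betax. *)
Lemma row_sum_le1 betax : (forall i, \sum_(j < n i) a i j <= 1) ->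
  is_maximum [set s : R | exists i : 'I_m, \sum_(j < n i) a i j `^ s = 1] betax ->
  forall i, \sum_(j < n i) a i j `^ betax <= 1.
Proof.
move=> asum [_ betax_max] i; rewrite leNgt; apply/negP => sum_gt1.
have a01 j : 0 < a i j < 1.
  by have [a0 [ab b1]] := hab i j; rewrite a0 (lt_trans ab).
have [s bs sE] := powR_sum_root _ _ _ a01 (asum i) sum_gt1.
by have := betax_max s (ex_intro _ i sE); rewrite leNgt bs.
Qed.

(** In a row with at least two digits, the sum at a negative exponent is at least
    the number of digits, so it exceeds 1. *)
Lemma max_exponent_ge0 betax : (forall i, \sum_(j < n i) a i j <= 1) ->
  (exists i, (2 <= n i)%N) ->
  is_maximum [set s : R | exists i : 'I_m, \sum_(j < n i) a i j `^ s = 1] betax ->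
  0 <= betax.
Proof.
move=> asum [i ni2] /(row_sum_le1 _ asum)/(_ i); rewrite leNgt => sum_le1.
rewrite leNgt; apply: contra sum_le1 => betax0.
apply: (@lt_le_trans _ _ (\sum_(j < n i) a i j `^ 0)).
  under eq_bigr => j _ do rewrite powRr0.
  by rewrite sumr_const card_ord (ltr_nat _ 1).
apply: ler_sum => j _; apply: ger_powR; last exact: ltW.
by have [-> [/ltW ab /ltW b1]] := hab i j; exact: le_trans ab b1.
Qed.

End Carpet.

(** * The Assouad dimension *)

Theorem theorem1p3 (R : realType) (m : nat) (n : 'I_m -> nat)
  (a c : forall i : 'I_m, 'I_(n i) -> R) (b d : 'I_m -> R)
  (S : set (R * R)) (betax betay : R)
  (hm : (2 <= m)%N)
  (hn : forall i, (1 <= n i)%N)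
  (hn2 : exists i, (2 <= n i)%N)
  (* (i) *)
  (hab : forall (i : 'I_m) (j : 'I_(n i)), 0 < a i j /\ a i j < b i /\ b i < 1)
  (hbsum : \sum_(i < m) b i <= 1)
  (hasum : forall i : 'I_m, \sum_(j < n i) a i j <= 1)
  (* (ii) *)
  (hd01 : forall i, 0 <= d i < 1)
  (hdlt : forall i i' : 'I_m, (i < i')%N -> d i < d i')
  (hdb : forall i i' : 'I_m, i' = i.+1 :> nat -> d i + b i <= d i')
  (hdlast : forall i : 'I_m, i.+1 = m -> d i + b i <= 1)
  (* (iii) *)
  (hc01 : forall (i : 'I_m) (j : 'I_(n i)), 0 <= c i j < 1)
  (hclt : forall (i : 'I_m) (j j' : 'I_(n i)), (j < j')%N -> c i j < c i j')
  (hca : forall (i : 'I_m) (j j' : 'I_(n i)),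
      j' = j.+1 :> nat -> c i j + a i j <= c i j')
  (hclast : forall (i : 'I_m) (j : 'I_(n i)), j.+1 = n i -> c i j + a i j <= 1)
  (hS : is_limit_set a c b d S)
  (hbetay01 : 0 < betay <= 1)
  (hbetay : \sum_(i < m) b i `^ betay = 1)
  (hbetax : is_maximum
      [set s : R | exists i : 'I_m, \sum_(j < n i) a i j `^ s = 1] betax) :
  assouad_dim euclid_dist S = (betax + betay)%:E.
Proof.
have /andP[betay_gt0 _] := hbetay01; have betay0 := ltW betay_gt0.
have xsum := row_sum_le1 a b hab betax hasum hbetax.
have betax0 := max_exponent_ge0 a b hab betax hasum hn2 hbetax.
have [amin [_ [amin01 amin_a amin_b _ _]]] := contraction_bounds a b hn hab.
apply/eqP; rewrite eq_le; apply/andP; split.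
  apply: ereal_inf_lbound; exists (betax + betay) => //; split.
    by rewrite ltr_wpDl.
  by apply: S_assouad_exponent; eassumption.
apply: le_ereal_inf_tmp => _ [alpha [alpha0 exponent] <-]; rewrite lee_fin.
have [[i0 sum_i0] _] := hbetax.
by apply: exponent_ge; eassumption.
Qed.
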